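(* Let $L$ be a split Lie algebra over a field $\mathbb{K}$ with splitting Cartan subalgebra $H$ and symmetric root system $\Lambda$, and let $V$ be a weight module over $L$ with respect to $H$ with symmetric weight system $\mathcal{P}$. If $\mathcal{Z}(L)=0$ and $H=\sum_{\alpha\in\Lambda}[L_\alpha,L_{-\alpha}]$, then $L$ is the direct sum of the ideals $I_{[\alpha]}$: $$L=\bigoplus_{[\alpha]\in\Lambda/\approx}I_{[\alpha]}.$$
   Context: $\mathbb{K}$ is an arbitrary field; there are no restrictions on the dimensions of $L$ or $V$. Split Lie algebra: a splitting Cartan subalgebra $H$ of a Lie algebra $L$ is a maximal abelian subalgebra such that the maps $\mathrm{ad}_h$, $h\in H$, are simultaneously diagonalizable; $L$ is split if it has such an $H$. Then $L=H\oplus\bigoplus_{\alpha\in\Lambda}L_\alpha$, where for $\alpha\in H^*$, $L_\alpha=\{x\in L:[h,x]=\alpha(h)x\ \forall h\in H\}$ and $\Lambda=\{\alpha\in H^*\setminus\{0\}:L_\alpha\neq0\}$ (and $L_0=H$). $\Lambda$ is symmetric if $\alpha\in\Lambda$ implies $-\alpha\in\Lambda$. Weight module: an $L$-module $V$ (so $[x,y]v=x(yv)-y(xv)$) is a weight module with respect to $H$ if $V=V_0\oplus\bigoplus_{\gamma\in\mathcal{P}}V_\gamma$, where $V_\gamma=\{v\in V:hv=\gamma(h)v\ \forall h\in H\}$ for $\gamma\in H^*$ and $\mathcal{P}=\{\gamma\in H^*\setminus\{0\}:V_\gamma\neq0\}$. $\mathcal{P}$ is symmetric if $\gamma\in\mathcal{P}$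 implies $-\gamma\in\mathcal{P}$. $[A,B]$ is the linear span of all brackets $[a,b]$. $\mathcal{Z}(L)=\{e\in L:[e,L]=0\}$. Connection of roots: for $\alpha,\beta\in\Lambda$, $\alpha$ is connected to $\beta$, written $\alpha\approx\beta$, if there exist $n\ge1$ and $\zeta_1,\dots,\zeta_n\in\Lambda\cup\mathcal{P}$ such that $\zeta_1=\alpha$; $\zeta_1,\ \zeta_1+\zeta_2,\ \dots,\ \zeta_1+\cdots+\zeta_{n-1}\in\Lambda\cup\mathcal{P}$; and $\zeta_1+\cdots+\zeta_n\in\{\beta,-\beta\}$ (sums in $H^*$). The relation $\approx$ is an equivalence relation on $\Lambda$; $\Lambda_\alpha=[\alpha]$ denotes the class of $\alpha$, and $$I_{[\alpha]}=L_{\Lambda_\alpha}:=H_{\Lambda_\alpha}\oplus N_{\Lambda_\alpha},\quad H_{\Lambda_\alpha}:=\mathrm{span}_{\mathbb{K}}\{[L_\beta,L_{-\beta}]:\beta\in\Lambda_\alpha\}\subset H,\quad N_{\Lambda_\alpha}:=\bigoplus_{\beta\in\Lambda_\alpha}L_\beta,$$ which is an ideal of $L$. *)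

(* Defs.v *)
From HB Require Import structures.
From mathcomp Require Import all_boot all_algebra.
From mathcomp Require Import boolp classical_sets functions.

Set Implicit Arguments.
Unset Strict Implicit.
Unset Printing Implicit Defensive.

Import GRing.Theory.
Local Open Scope classical_set_scope.
Local Open Scope ring_scope.

HB.mixin Record Lmodule_isLieAlgebra (K : fieldType) L
    of GRing.Lmodule K L := {
  lie : L -> L -> L;
  lie_linearl : forall y, linear (fun x => lie x y);
  lie_linearr : forall x, linear (lie x);
  liexx : forall x, lie x x = 0;
  lie_jacobi : forall x y z,
    lie x (lie y z) + lie y (lie z x) + lie z (lie x y) = 0
}.

#[short(type="lieAlgType")]
HB.structure Definition LieAlgebra (K : fieldType) :=
  {L of GRing.Lmodule K L & Lmodule_isLieAlgebra K L}.

HB.mixin Record Lmodule_isLieModule (K : fieldType) (L : lieAlgType K) V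
    of GRing.Lmodule K V := {
  lie_act : L -> V -> V;
  lie_act_linearl : forall v, linear (fun x => lie_act x v);
  lie_act_linearr : forall x, linear (lie_act x);
  lie_act_lie : forall x y v,
    lie_act (lie x y) v = lie_act x (lie_act y v) - lie_act y (lie_act x v)
}.

#[short(type="lieModType")]
HB.structure Definition LieModule (K : fieldType) (L : lieAlgType K) :=
  {V of GRing.Lmodule K V & Lmodule_isLieModule K L V}.

Section LinearAlgebra.
Variables (K : fieldType) (U : lmodType K).

Definition is_subspace (A : set U) : Prop := submod_closed [in A].

Definition lspan (A : set U) : set U := smallest is_subspace A.

Definition lin_indep (B : set U) : Prop :=
  forall (s : seq U) (c : U -> K), uniq s -> (forall v, v \in s -> B v) ->
    \sum_(v <- s) c v *: v = 0 -> forall v, v \in s -> c v = 0.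

Definition is_basis (B : set U) : Prop := lin_indep B /\ lspan B = [set: U].

(* [S] is the internal direct sum of the subspaces [W i], [i] in [D]. *)
Definition direct_sum (I : Type) (D : set I) (W : I -> set U) (S : set U) :
    Prop :=
  S = lspan (\bigcup_(i in D) W i) /\
  forall i, D i -> W i `&` lspan (\bigcup_(j in D `\ i) W j) = [set 0].

Definition simultaneously_diagonalizable (F : set (U -> U)) : Prop :=
  exists2 B : set U, is_basis B &
    forall f b, F f -> B b -> exists c : K, f b = c *: b.

(* Linear forms on a subspace [H], represented as functions on the subtype
   [set_type H] so that they carry the pointwise zmodType structure; [z] ranges
   over the element of the subtype whose value is [a *: x + y]. *)
Definition lin_dual (H : set U) : set (set_type H -> K) :=
  [set f | forall (a : K) (x y z : set_type H),
     val z = a *: val x + val y -> f z = a * f x + f y].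

End LinearAlgebra.

Definition symmetric_system (M : zmodType) (A : set M) : Prop :=
  forall a, A a -> A (- a).

Section SplitLieAlgebra.
Variables (K : fieldType) (L : lieAlgType K).

Definition lie_span (A B : set L) : set L :=
  lspan [set lie a b | a in A & b in B].

Definition lie_center : set L := [set e | forall x, lie e x = 0].

Definition is_lie_ideal (A : set L) : Prop :=
  is_subspace A /\ forall a x, A a -> A (lie a x).

Definition is_abelian_subalgebra (A : set L) : Prop :=
  [/\ is_subspace A, forall x y, A x -> A y -> A (lie x y)
    & forall x y, A x -> A y -> lie x y = 0].

Definition is_maximal_abelian_subalgebra (H : set L) : Prop :=
  is_abelian_subalgebra H /\
  forall A, is_abelian_subalgebra A -> H `<=` A -> A = H.

Definition is_splitting_cartan (H : set L) : Prop :=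
  is_maximal_abelian_subalgebra H /\
  simultaneously_diagonalizable [set lie h | h in H].

Variable H : set L.

Definition root_space (a : set_type H -> K) : set L :=
  [set x | forall h : set_type H, lie (val h) x = a h *: x].

Definition root_system : set (set_type H -> K) :=
  [set a | [/\ lin_dual a, a <> 0 & root_space a <> [set 0]]].

Variable V : lieModType L.

Definition weight_space (g : set_type H -> K) : set V :=
  [set v | forall h : set_type H, lie_act (val h) v = g h *: v].

Definition weight_system : set (set_type H -> K) :=
  [set g | [/\ lin_dual g, g <> 0 & weight_space g <> [set 0]]].

Definition is_weight_module : Prop :=
  direct_sum ([set 0] `|` weight_system) weight_space [set: V].

Definition connected_roots (a b : set_type H -> K) : Prop :=
  exists (n : nat) (z : nat -> set_type H -> K),
    [/\ (0 < n)%N,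
        forall i, (i < n)%N -> (root_system `|` weight_system) (z i),
        z 0%N = a,
        forall k, (0 < k < n)%N -> (root_system `|` weight_system) (\sum_(i < k) z i)
      & \sum_(i < n) z i = b \/ \sum_(i < n) z i = - b].

Definition root_class (a : set_type H -> K) : set (set_type H -> K) :=
  [set b | root_system b /\ connected_roots a b].

Definition root_classes : set (set (set_type H -> K)) :=
  [set root_class a | a in root_system].

End SplitLieAlgebra.

Section ClassIdeal.
Variables (K : fieldType) (L : lieAlgType K) (H : set L).

Definition class_cartan (C : set (set_type H -> K)) : set L :=
  lspan (\bigcup_(b in C) lie_span (root_space b) (root_space (- b))).

Definition class_root_part (C : set (set_type H -> K)) : set L :=
  lspan (\bigcup_(b in C) root_space b).

Definition class_ideal (C : set (set_type H -> K)) : set L :=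
  [set x + y | x in class_cartan C & y in class_root_part C].

End ClassIdeal.

Arguments lie_center {K} L.
Arguments root_system {K L} H.
Arguments weight_system {K L} H V.
Arguments is_weight_module {K L} H V.
Arguments weight_space {K L H} V g.
Arguments connected_roots {K L H} V a b.
Arguments root_class {K L H} V a.
Arguments root_classes {K L} H V.
Arguments class_ideal {K L} H C.

(* Main.v *)
(** Two roots that are not connected have commuting root spaces, since a nonzero
    bracket of [L_a] and [L_b] forces [a + b] to be zero or a root. By the Jacobi
    identity, ideals of distinct classes therefore commute. As [H] is generated
    by the brackets [L_a, L_-a], these ideals span [L]. An element of one of
    them that also lies in the span of the others then commutes with all of
    [L], so it vanishes because the center is trivial. *)
Require Import Defs.
From mathcomp Require Import all_boot all_algebra.
From mathcomp Require Import boolp classical_sets functions.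
From Stdlib Require Import Relation_Operators Operators_Properties.

Set Implicit Arguments.
Unset Strict Implicit.
Unset Printing Implicit Defensive.

Import GRing.Theory.
Local Open Scope classical_set_scope.
Local Open Scope ring_scope.

(** * Subspaces, spans and sums of subspaces *)

Section Subspaces.
Context {K : fieldType} {U : lmodType K}.
Implicit Types A B S : set U.

Lemma is_subspaceP A :
  is_subspace A <-> A 0 /\ forall a x y, A x -> A y -> A (a *: x + y).
Proof.
split=> [[A0 Al]|[A0 Al]]; split.
- by move: A0; rewrite inE.
- by move=> a x y Ax Ay; move: (Al a x y); rewrite !inE; apply.
- by rewrite inE.
- by move=> a x y; rewrite !inE; apply: Al.
Qed.

Lemma subspaceD A x y : is_subspace A -> A x -> A y -> A (x + y).
Proof. by move=> /is_subspaceP[_ Al] Ax Ay; rewrite -(scale1r x); apply: Al. Qed.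

Lemma subspaceN A x : is_subspace A -> A x -> A (- x).
Proof.
by move=> /is_subspaceP[A0 Al] Ax; rewrite -scaleN1r -[_ *: _]addr0; apply: Al.
Qed.

Lemma subspace_set0 : is_subspace [set (0 : U)].
Proof.
by apply/is_subspaceP; split=> // a x y /= -> ->; rewrite scaler0 addr0.
Qed.

Lemma subset_lspan A : A `<=` lspan A.
Proof. exact: sub_smallest. Qed.

Lemma lspan_subset A S : is_subspace S -> A `<=` S -> lspan A `<=` S.
Proof. by move=> Ss AS; apply: smallest_sub. Qed.

Lemma lspan_subspace A : is_subspace (lspan A).
Proof.
apply/is_subspaceP; split=> [S [/is_subspaceP[]] //|a x y Ax Ay S [Ss AS]].
have /is_subspaceP[_ Sl] := Ss.
by apply: Sl; [apply: Ax|apply: Ay].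
Qed.

Lemma subspace_sumset A B : is_subspace A -> is_subspace B ->
  is_subspace [set x + y | x in A & y in B].
Proof.
move=> /is_subspaceP[A0 Al] /is_subspaceP[B0 Bl]; apply/is_subspaceP; split.
  by exists 0 => //; exists 0 => //; rewrite addr0.
move=> a _ _ [x Ax [y By <-]] [x' Ax' [y' By' <-]].
exists (a *: x + x'); first exact: Al.
exists (a *: y + y'); first exact: Bl.
by rewrite scalerDr addrACA.
Qed.

End Subspaces.

(** * Connection by chains in a symmetric subset of an abelian group *)

Section Chains.
Context {M : zmodType}.
Variable A : set M.

(** Two consecutive partial sums of a chain: both lie in [A], and so does the term added between
    them. *)
Definition chain_step (x y : M) := [/\ A x, A y & A (y - x)].

(* [connected_roots] for an arbitrary set [A] in place of the roots and
   weights. *)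
Definition chain_connected (a b : M) : Prop :=
  exists (n : nat) (z : nat -> M),
    [/\ (0 < n)%N, forall i, (i < n)%N -> A (z i), z 0%N = a,
        forall k, (0 < k < n)%N -> A (\sum_(i < k) z i)
      & \sum_(i < n) z i = b \/ \sum_(i < n) z i = - b].

Hypothesis symA : symmetric_system A.

Notation reach := (clos_refl_trans M chain_step).

Lemma reach_sym x y : reach x y -> reach y x.
Proof.
elim=> {x y} [x y [Ax Ay Ayx]|x|x y z _ yx _ zy].
- by apply: rt_step; split=> //; rewrite -opprB; apply: symA.
- exact: rt_refl.
- exact: rt_trans zy yx.
Qed.

Lemma reachN x y : reach x y -> reach (- x) (- y).
Proof.
elim=> {x y} [x y [Ax Ay Ayx]|x|x y z _ xy _ yz].
- by apply: rt_step; split; [apply: symA|apply: symA|rewrite -opprD; apply: symA].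
- exact: rt_refl.
- exact: rt_trans xy yz.
Qed.

(** The partial sums of a chain form a walk along [chain_step], and the successive differences of a
    walk form a chain. Symmetry and transitivity can then be read off walks, without concatenating
    sequences. *)
Lemma chain_connectedP a b : A a -> A b ->
  chain_connected a b <-> reach a b \/ reach a (- b).
Proof.
move=> Aa Ab; split=> [[n [z [n0 Az z0 Apart zn]]]|].
  (* Chains only ask the proper partial sums to lie in [A]; the full sum does because it is [b] or
     [- b]. *)
  have An : A (\sum_(i < n) z i) by case: zn => ->; [|apply: symA].
  have Ale k : (k < n)%N -> A (\sum_(i < k.+1) z i).
    by move=> /[1!leq_eqVlt] /predU1P[-> //|kn]; apply: Apart.
  have r k : (k < n)%N -> reach a (\sum_(i < k.+1) z i).
    elim: k => [_|k IHk kn]; first by rewrite big_ord1 z0; apply: rt_refl.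
    apply: rt_trans (IHk (ltnW kn)) _; apply: rt_step; split.
    - exact/Ale/ltnW.
    - exact: Ale.
    - by rewrite [X in X - _]big_ord_recr /= addrAC subrr add0r; apply: Az.
  have := r n.-1; rewrite prednK // => /(_ (leqnn _)).
  by case: zn => ->; [left|right].
have chain c : reach a c -> exists n (z : nat -> M),
    [/\ (0 < n)%N, forall i, (i < n)%N -> A (z i), z 0%N = a,
        forall k, (0 < k <= n)%N -> A (\sum_(i < k) z i) & \sum_(i < n) z i = c].
  (* The closure is taken with steps added on the right, so that each induction step appends one
     term, [y - x], to the chain. *)
  move=> /(@clos_rt_rtn1 M chain_step a c) ac; elim: ac => {c} [|x y [Ax Ay Ayx] _ [n [z [n0 Az z0 Ap zn]]]].
    exists 1%N, (fun=> a); split=> //; last by rewrite big_ord1.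
    by case=> [|[|k]] //; rewrite big_ord1.
  pose z' i := if (i < n)%N then z i else y - x.
  have z'E k : (k <= n)%N -> \sum_(i < k) z' i = \sum_(i < k) z i.
    by move=> kn; apply: eq_bigr => i _; rewrite /z' (leq_trans (ltn_ord i) kn).
  have z'n : \sum_(i < n.+1) z' i = y.
    by rewrite big_ord_recr /= z'E // zn /z' ltnn addrC subrK.
  exists n.+1, z'; split=> // [i _||k /andP[k0]].
  - by rewrite /z'; case: ifPn => // /Az.
  - by rewrite /z' n0.
  - rewrite leq_eqVlt => /predU1P[->|kn]; first by rewrite z'n.
    by rewrite z'E //; apply: Ap; rewrite k0.
case=> /chain[n [z [n0 Az z0 Ap zn]]]; exists n, z; split=> //; try by
  [move=> k /andP[k0 /ltnW kn]; apply: Ap; rewrite k0|left|right].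
Qed.

Lemma chain_connected_sym a b : A a -> A b ->
  chain_connected a b -> chain_connected b a.
Proof.
move=> Aa Ab /chain_connectedP-/(_ Aa Ab) ab; apply/chain_connectedP => //.
case: ab => [/reach_sym|/reachN/reach_sym]; first by left.
by rewrite opprK; right.
Qed.

(** If the first walk ends at [- b], negating the walk that starts at [b] makes the two fit
    together. *)
Lemma chain_connected_trans a b c : A a -> A b -> A c ->
  chain_connected a b -> chain_connected b c -> chain_connected a c.
Proof.
move=> Aa Ab Ac /chain_connectedP-/(_ Aa Ab) ab.
move=> /chain_connectedP-/(_ Ab Ac) bc; apply/chain_connectedP => //.
case: ab => ab.
  by case: bc => bc; [left|right]; apply: rt_trans ab bc.
by case: bc => /reachN bc; [right|left; rewrite -(opprK c)]; apply: rt_trans ab bc.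
Qed.

Lemma chain_connected_step a b : A a -> A b -> A (b - a) -> chain_connected a b.
Proof.
by move=> Aa Ab Aba; apply/chain_connectedP => //; left; apply: rt_step.
Qed.

Lemma chain_connected_opp a b : chain_connected a b -> chain_connected a (- b).
Proof.
move=> [n [z [n0 Az z0 Ap zn]]]; exists n, z; split=> //.
by rewrite opprK; case: zn; [right|left].
Qed.

Lemma chain_connected_refl a : A a -> chain_connected a a.
Proof. by move=> Aa; apply/chain_connectedP => //; left; apply: rt_refl. Qed.

End Chains.

(** * Bilinearity, antisymmetry and the derivation form of the Jacobi identity *)

Section LieAlgebras.
Context {K : fieldType} {L : lieAlgType K}.
Implicit Types (x y z : L) (A B S : set L).

Lemma lieDl x y z : lie (x + y) z = lie x z + lie y z.
Proof. by have /= := lie_linearl z 1 x y; rewrite !scale1r. Qed.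

Lemma lieDr x y z : lie x (y + z) = lie x y + lie x z.
Proof. by have /= := lie_linearr x 1 y z; rewrite !scale1r. Qed.

Lemma lie0l x : lie 0 x = 0.
Proof. by apply: (addrI (lie 0 x)); rewrite -lieDl !addr0. Qed.

Lemma lie0r x : lie x 0 = 0.
Proof. by apply: (addrI (lie x 0)); rewrite -lieDr !addr0. Qed.

Lemma lieZl a x y : lie (a *: x) y = a *: lie x y.
Proof. by have /= := lie_linearl y a x 0; rewrite lie0l !addr0. Qed.

Lemma lieZr a x y : lie x (a *: y) = a *: lie x y.
Proof. by have /= := lie_linearr x a y 0; rewrite lie0r !addr0. Qed.

Lemma lieC x y : lie x y = - lie y x.
Proof.
apply/eqP; rewrite -addr_eq0; apply/eqP.
by have := liexx (x + y); rewrite lieDl !lieDr !liexx add0r addr0.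
Qed.

Lemma lieNr x y : lie x (- y) = - lie x y.
Proof. by rewrite -scaleN1r lieZr scaleN1r. Qed.

Lemma lie_derivation x y z : lie x (lie y z) = lie (lie x y) z + lie y (lie x z).
Proof.
apply/eqP; rewrite -subr_eq0 -(lie_jacobi x y z) opprD.
by rewrite -[- lie (lie x y) z]lieC -[- lie y _]lieNr -[- lie x z]lieC addrA addrAC.
Qed.

Lemma lie_lie_eq0 x y z : lie x z = 0 -> lie y z = 0 -> lie (lie x y) z = 0.
Proof.
move=> xz yz; have := lie_derivation x y z.
by rewrite xz yz !lie0r addr0.
Qed.

Lemma subspace_lie_preimage S y : is_subspace S -> is_subspace [set x | S (lie x y)].
Proof.
move=> /is_subspaceP[S0 Sl]; apply/is_subspaceP; split=> [|a u v Su Sv] /=.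
  by rewrite lie0l.
by rewrite lieDl lieZl; apply: Sl.
Qed.

Lemma subspace_lier_preimage S x : is_subspace S -> is_subspace [set y | S (lie x y)].
Proof.
move=> /is_subspaceP[S0 Sl]; apply/is_subspaceP; split=> [|a u v Su Sv] /=.
  by rewrite lie0r.
by rewrite lieDr lieZr; apply: Sl.
Qed.

(** * A maximal abelian subalgebra is its own centralizer *)

Section MaximalAbelian.
Context {H : set L}.
Hypothesis maxH : is_maximal_abelian_subalgebra H.

Lemma maximal_abelian_centralizer x : (forall h, H h -> lie h x = 0) -> H x.
Proof.
move=> Hx; have [[Hs _ Hab] Hmax] := maxH.
have [H0 Hl] := (is_subspaceP H).1 Hs.
(* The sum of [H] and the line through [x] is again abelian, so maximality makes it equal to [H]. *)
pose A := [set h + y | h in H & y in [set a *: x | a in [set: K]]].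
have Aab y z : A y -> A z -> lie y z = 0.
  move=> [h Hh [_ [a _ <-] <-]] [k Hk [_ [b _ <-] <-]].
  rewrite lieDl !lieDr !lieZl !lieZr liexx Hab // Hx // lieC Hx //.
  by rewrite oppr0 !scaler0 !addr0.
have As : is_subspace A.
  apply: subspace_sumset => //; apply/is_subspaceP; split=> [|a _ _ [b _ <-] [c _ <-]].
    by exists 0 => //; rewrite scale0r.
  by exists (a * b + c) => //; rewrite scalerDl scalerA.
have HA : H `<=` A.
  by move=> h Hh; exists h => //; exists 0; rewrite ?addr0 //; exists 0; rewrite ?scale0r.
rewrite -(Hmax A _ HA).
  by exists 0 => //; exists x; rewrite ?add0r //; exists 1; rewrite ?scale1r.
split=> // y z Ay Az; rewrite (Aab _ _ Ay Az).
by have [] := (is_subspaceP A).1 As.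
Qed.

End MaximalAbelian.

(** * Root spaces and classes of connected roots *)

Section Roots.
Context {H : set L}.
Implicit Types a b c : set_type H -> K.

Lemma root_spaceD a b x y :
  root_space a x -> root_space b y -> root_space (a + b) (lie x y).
Proof.
by move=> ax bY h; rewrite lie_derivation ax bY lieZl lieZr -scalerDl.
Qed.

(** Linearity of [a] is automatic: bracketing is linear in its first argument, and eigenvalues can
    be compared on the nonzero vector [x]. *)
Lemma root_system_intro a x :
  is_subspace H -> a <> 0 -> root_space a x -> x <> 0 -> root_system H a.
Proof.
move=> Hs a0 ax x0; split=> //; last by move=> /seteqP[/(_ _ ax)].
move=> k h1 h2 h3 h3E; apply/eqP; rewrite -subr_eq0.
have : (a h3 - (k * a h1 + a h2)) *: x = 0.
  rewrite scalerBl scalerDl -scalerA -!ax h3E lieDl lieZl.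
  by rewrite subrr.
by move=> /eqP; rewrite scaler_eq0 => /orP[//|/eqP].
Qed.

Context {V : lieModType L}.
Local Notation roots := (root_system H).
Local Notation weights := (weight_system H V).

Hypothesis splitH : is_splitting_cartan H.
Hypothesis symL : symmetric_system roots.
Hypothesis symV : symmetric_system weights.

Let A := roots `|` weights.

Let symA : symmetric_system A.
Proof. by move=> a [/symL|/symV]; [left|right]. Qed.

Let Hs : is_subspace H.
Proof. by have [[[]]] := splitH. Qed.

Lemma connected_roots_sym a b : roots a -> roots b ->
  connected_roots V a b -> connected_roots V b a.
Proof. by move=> ra rb; apply: (@chain_connected_sym _ A symA); left. Qed.

Lemma connected_roots_trans a b c : roots a -> roots b -> roots c ->
  connected_roots V a b -> connected_roots V b c -> connected_roots V a c.
Proof. by move=> ra rb rc; apply: (@chain_connected_trans _ A symA); left. Qed.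

Lemma root_class_refl a : roots a -> root_class V a a.
Proof. by move=> ra; split=> //; apply: (@chain_connected_refl _ A symA); left. Qed.

Lemma root_class_opp a b : root_class V a b -> root_class V a (- b).
Proof.
by move=> [rb ab]; split; [apply: symL|apply: (@chain_connected_opp _ A)].
Qed.

(** The step from [b] to [b + c] is allowed because its difference [c] is a root. *)
Lemma root_class_add a b c : root_class V a b -> roots c -> roots (b + c) ->
  roots a -> root_class V a (b + c).
Proof.
move=> [rb ab] rc rbc ra; split=> //; apply: connected_roots_trans ab _ => //.
by apply: (@chain_connected_step _ A symA); left; rewrite // addrC addKr.
Qed.

Lemma root_class_eq a b c d : roots a -> roots b ->
  root_class V a c -> root_class V b d -> connected_roots V c d ->
  root_class V a = root_class V b.
Proof.
move=> ra rb [rc ac] [rd bd] cd.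
have ab : connected_roots V a b.
  have db : connected_roots V d b by exact: connected_roots_sym.
  have ad : connected_roots V a d by exact: connected_roots_trans ac cd.
  exact: connected_roots_trans ad db.
have ba : connected_roots V b a by exact: connected_roots_sym.
apply/seteqP; split=> e [re ae]; split=> //.
- exact: connected_roots_trans ba ae.
- exact: connected_roots_trans ab ae.
Qed.

Lemma unconnected_root_spaces_commute a b x y : roots a -> roots b ->
  ~ connected_roots V a b -> root_space a x -> root_space b y -> lie x y = 0.
Proof.
move=> ra rb nab ax bY; apply: contrapT => xy0; apply: nab.
(* Aim at [- b] instead of [b]: the difference from [a] is then [- (a + b)], which is zero or a
   root. *)
rewrite -[b]opprK; apply: (@chain_connected_opp _ A).
have [ab0|ab0] := pselect (a + b = 0).
  have -> : - b = a by apply/esym/eqP; rewrite -addr_eq0 ab0.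
  by apply: (@chain_connected_refl _ A symA); left.
apply: (@chain_connected_step _ A symA); [by left|by left; apply: symL|].
rewrite -opprD; left; apply: symL; rewrite addrC.
exact: root_system_intro (root_spaceD ax bY) xy0.
Qed.

(** * Generators of the ideal attached to a class *)

Section ClassIdeal.
Variable C : set (set_type H -> K).

Lemma class_ideal_subspace : is_subspace (class_ideal H C).
Proof. by apply: subspace_sumset; apply: lspan_subspace. Qed.

Lemma class_ideal_cartan : class_cartan C `<=` class_ideal H C.
Proof.
move=> x Cx; exists x => //; exists 0; rewrite ?addr0 //.
by have /is_subspaceP[] := lspan_subspace (\bigcup_(b in C) @root_space K L H b).
Qed.

Lemma class_ideal_lie_span b : C b ->
  lie_span (root_space b) (root_space (- b)) `<=` class_ideal H C.
Proof.
by move=> Cb x bx; apply: class_ideal_cartan; apply: subset_lspan; exists b.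
Qed.

Lemma class_ideal_root_space b : C b -> root_space b `<=` class_ideal H C.
Proof.
move=> Cb x bx; exists 0; last exists x; rewrite ?add0r //.
  by have /is_subspaceP[] := lspan_subspace
    (\bigcup_(b in C) lie_span (@root_space K L H b) (root_space (- b))).
by apply: subset_lspan; exists b.
Qed.

(** Induction principle for [class_ideal]: linear properties need checking only on root vectors and
    on brackets of opposite root vectors. *)
Lemma class_ideal_subset S : is_subspace S ->
  (forall b, C b -> root_space b `<=` S) ->
  (forall b x y, C b -> root_space b x -> root_space (- b) y -> S (lie x y)) ->
  class_ideal H C `<=` S.
Proof.
move=> Ss Sroot Slie _ [x Cx [y Cy <-]]; apply: subspaceD => //.
  apply: lspan_subset x Cx => // x [b Cb]; apply: lspan_subset x => //.
  by move=> _ [u bu [v bv <-]]; apply: Slie bu bv.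
by apply: lspan_subset y Cy => // y [b Cb]; apply: Sroot.
Qed.

End ClassIdeal.

(** * Distinct class ideals commute *)

Local Notation classes := (root_classes H V).

(** Generators are treated one argument at a time. Brackets of opposite root vectors reduce to root
    vectors by [lie_lie_eq0], since a class is closed under negation. *)
Lemma class_ideals_commute C D x y : classes C -> classes D -> C <> D ->
  class_ideal H C x -> class_ideal H D y -> lie x y = 0.
Proof.
move=> [a ra <-] [b rb <-] nCD.
have comm c d u v : root_class V a c -> root_class V b d ->
    root_space c u -> root_space d v -> lie u v = 0.
  move=> ac bd; have [rc _] := ac; have [rd _] := bd.
  apply: unconnected_root_spaces_commute => // cd.
  exact/nCD/(root_class_eq ra rb ac bd cd).
have comml d v : root_class V b d -> root_space d v ->
    forall u, class_ideal H (root_class V a) u -> lie u v = 0.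
  move=> bd dv; apply: class_ideal_subset.
  - exact: subspace_lie_preimage subspace_set0.
  - by move=> c ac u cu; apply: comm ac bd cu dv.
  - move=> c u w ac cu cw; apply: lie_lie_eq0; first exact: comm ac bd cu dv.
    exact: comm (root_class_opp ac) bd cw dv.
move=> Cx; move: y; apply: class_ideal_subset.
- exact: subspace_lier_preimage subspace_set0.
- by move=> d bd v dv; apply: comml bd dv _ Cx.
- move=> d v w bd dv dw /=; rewrite lieC lie_lie_eq0 ?oppr0 // lieC.
    by rewrite (comml _ _ bd dv) // oppr0.
  by rewrite (comml _ _ (root_class_opp bd) dw) // oppr0.
Qed.

(** * Ideal property, spanning and directness when [H] is generated by brackets *)

Hypothesis genH : H = lspan (\bigcup_(a in roots)
                               lie_span (root_space a) (root_space (- a))).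

Lemma lie_root_space_opp a x y :
  roots a -> root_space a x -> root_space (- a) y -> H (lie x y).
Proof.
move=> ra ax ay; rewrite genH; apply: subset_lspan; exists a => //.
by apply: subset_lspan; exists x => //; exists y.
Qed.

Lemma root_space_lie_cartan a h x : H h -> root_space a x -> root_space a (lie h x).
Proof.
move=> Hh ax; have hH : h \in H by rewrite inE.
rewrite (ax (SigSub hH)) => k; rewrite lieZr ax !scalerA.
by rewrite mulrC.
Qed.

(** Only closure under the internal bracket is shown here; brackets with the rest of [L] are handled
    once the ideals are known to span. *)
Lemma class_ideal_lie C x y : classes C ->
  class_ideal H C x -> class_ideal H C y -> class_ideal H C (lie x y).
Proof.
move=> [a ra <-]; set C' := root_class V a => Cx; move: y.
have Is := class_ideal_subspace C'.
have [I0 _] := (is_subspaceP _).1 Is.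
have HI b v h : C' b -> root_space b v -> H h -> class_ideal H C' (lie h v).
  by move=> Cb bv Hh; apply: (class_ideal_root_space Cb) => //;
    apply: root_space_lie_cartan.
move: x Cx; apply: class_ideal_subset.
- apply/is_subspaceP; split=> [y _|k u v Iu Iv y Iy]; first by rewrite lie0l.
  have [_ Il] := (is_subspaceP _).1 Is.
  by rewrite lieDl lieZl; apply: Il; [apply: Iu|apply: Iv].
- move=> b Cb x bx; apply: class_ideal_subset; first exact: subspace_lier_preimage.
    move=> c Cc y cy /=; have [->//|xy0] := pselect (lie x y = 0).
    (* Opposite roots give a bracket in the Cartan part; otherwise [b + c] is a root, and it stays
       in the class. *)
    have [bc0|bc0] := pselect (b + c = 0).
      apply: (class_ideal_lie_span Cb); apply: subset_lspan.
      exists x => //; exists y => //.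
      by have -> : - b = c by apply/eqP; rewrite eq_sym -addr_eq0 addrC bc0.
    have bcxy := root_spaceD bx cy.
    apply: class_ideal_root_space (bcxy); apply: root_class_add => //.
    - by have [] := Cc.
    - exact: root_system_intro bcxy xy0.
  move=> c u v Cc cu cv /=; rewrite lieC; apply: subspaceN => //.
  by apply: HI bx _ => //; apply: lie_root_space_opp cu cv; have [] := Cc.
- move=> b u v Cb bu bv.
  have Huv : H (lie u v) by apply: lie_root_space_opp bu bv; have [] := Cb.
  apply: class_ideal_subset; first exact: subspace_lier_preimage.
    by move=> c Cc y cy; apply: HI cy Huv.
  (* Both brackets lie in [H], which is abelian. *)
  move=> c w z Cc cw cz /=; have [[[_ _ Hab] _] _] := splitH.
  by rewrite Hab //; apply: lie_root_space_opp cw cz; have [] := Cc.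
Qed.

(** Each vector of a diagonalizing basis either commutes with [H], hence lies in [H], or is a root
    vector. *)
Lemma class_ideals_span :
  lspan (\bigcup_(C in classes) class_ideal H C) = [set: L].
Proof.
set S := lspan _; have Ss : is_subspace S by exact: lspan_subspace.
have IS a : roots a -> class_ideal H (root_class V a) `<=` S.
  by move=> ra x Ix; apply: subset_lspan; exists (root_class V a) => //; exists a.
have HS : H `<=` S.
  rewrite genH; apply: lspan_subset => // x [a ra ax]; apply: (IS a) => //.
  exact: class_ideal_lie_span (root_class_refl ra) _ ax.
have [maxH [B [_ spanB] diagB]] := splitH.
rewrite -subTset -spanB; apply: lspan_subset => // b Bb.
have [->|b0] := pselect (b = 0); first by have [] := (is_subspaceP S).1 Ss.
(* The eigenvalues of [b] are collected into one function [a] on [H]. *)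
have /choice[a ba] : forall h : set_type H, exists k : K, lie (val h) b = k *: b.
  move=> h; apply: (diagB (lie (val h))) => //; exists (val h) => //.
  by have := valP h; rewrite inE.
have [a0|a0] := pselect (a = 0).
  apply: HS; apply: (maximal_abelian_centralizer maxH) => h Hh.
  have hH : h \in H by rewrite inE.
  by rewrite (ba (SigSub hH)) a0 scale0r.
have ra : roots a by exact: root_system_intro ba b0.
by apply: (IS a ra); apply: (class_ideal_root_space (root_class_refl ra)).
Qed.

(** By spanning, it suffices to bracket with one class ideal at a time: the same class stays inside,
    and any other class gives zero. *)
Lemma class_ideal_is_lie_ideal C : classes C -> is_lie_ideal (class_ideal H C).
Proof.
move=> hC; have Is := class_ideal_subspace C; split=> // x y Ix.
have: lspan (\bigcup_(D in classes) class_ideal H D) y by rewrite class_ideals_span.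
move: y; apply: lspan_subset; first exact: subspace_lier_preimage.
move=> y [D hD Iy] /=; have [DC|nDC] := pselect (C = D).
  by apply: class_ideal_lie => //; rewrite DC.
rewrite (class_ideals_commute hC hD nDC Ix Iy).
by have [] := (is_subspaceP _).1 Is.
Qed.

Lemma class_ideals_direct_sum : lie_center L = [set 0] ->
  direct_sum classes (class_ideal H) [set: L].
Proof.
move=> centerL; split=> [|C hC]; first by rewrite class_ideals_span.
have span0 : lspan (\bigcup_(D in classes `\ C) class_ideal H D) 0.
  by have [] := (is_subspaceP _).1
    (lspan_subspace (\bigcup_(D in classes `\ C) class_ideal H D)).
apply/seteqP; split=> [x [Cx sx]|_ ->]; last first.
  by split=> //; have [] := (is_subspaceP _).1 (class_ideal_subspace C).
rewrite -centerL => y.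
have: lspan (\bigcup_(D in classes) class_ideal H D) y by rewrite class_ideals_span.
move: y; apply: lspan_subset; first exact: subspace_lier_preimage subspace_set0.
(* For [D] other than [C], use that [x] lies in the ideal of [C]; for [D] equal to [C], use that [x]
   lies in the span of the other ideals. *)
move=> y [D hD Dy] /=; have [CD|nCD] := pselect (C = D); last first.
  exact: class_ideals_commute Cx Dy.
rewrite -CD in Dy; move: x sx {Cx}.
apply: lspan_subset; first exact: subspace_lie_preimage subspace_set0.
by move=> x [E [hE nEC] Ex] /=; exact: class_ideals_commute Ex Dy.
Qed.

End Roots.
End LieAlgebras.

Theorem theorem3p2 (K : fieldType) (L : lieAlgType K) (H : set L)
    (V : lieModType L)
    (splitH : is_splitting_cartan H)
    (symL : symmetric_system (root_system H))
    (weightV : is_weight_module H V)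
    (symV : symmetric_system (weight_system H V))
    (centerL : lie_center L = [set 0])
    (genH : H = lspan (\bigcup_(a in root_system H)
                         lie_span (root_space a) (root_space (- a)))) :
  (forall C, root_classes H V C -> is_lie_ideal (class_ideal H C)) /\
  direct_sum (root_classes H V) (class_ideal H) [set: L].
Proof.
split; first by move=> C; apply: class_ideal_is_lie_ideal.
exact: class_ideals_direct_sum.
Qed.
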